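(* There exists an abelian group $A$ with torsion-free rank $r_0(A)=1$ and such that, for every prime $p$, the $p$-component of $A$ has order $p$, for which the ideal of inertial endomorphisms of $A$ annihilating $A/T$ has the form $UI(A)=X+F(A)$, where $T=T(A)$ is the torsion subgroup of $A$ and $X$ is the ideal of all endomorphisms of $A$ annihilating both $A/T$ and $T$. Moreover, concerning additive groups, $X\simeq\prod_p\mathbb Z(p)$ (product over all primes) and $UI(A)/F(A)$ is an uncountable torsion-free divisible abelian group.
   Context: Groups are abelian, written additively. The torsion-free rank $r_0(A)$ is the rank of $A/T(A)$. An endomorphism $\varphi$ of $A$ is inertial if $H$ has finite index in $H+\varphi(H)$ for every subgroup $H\le A$; the inertial endomorphisms form a ring $IE(A)$. ''$\varphi$ annihilates $A/T$'' means that the induced endomorphism of $A/T$ is zero, i.e. $\varphi(A)\le T$; ''$\varphi$ annihilates $T$'' means $\varphi(T)=0$. $F(A)$ is the ideal of finitary endomorphisms, i.e. those with finite image. $\mathbb Z(p)$ is the cyclic group of order $p$. $UI(A)$ is the ring of uniform inertial endomorphisms: an inertial endomorphism $\varphi$ of $A$ is uniform if there are $\varphi$-invariant subgroups $F\le A_0\le A$ such that $A/A_0$ is finite, $A_0/F$ is periodic (torsion) and $\varphi$ acts on $A_0/F$ as multiplication by some $\alpha\in\mathcal J$, and $F$ is free abelian with $\varphi=0$ on $F$. Here $\mathcal J=\prod_pQ_p^*$, with $Q_p^*$ the ring of $p$-adic integers, acts componentwise on every periodic abelian group. *)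

(* Defs.v *)
From HB Require Import structures.
From mathcomp Require Import all_boot all_order all_algebra.
From mathcomp Require Import generic_quotient ring_quotient.
From mathcomp Require Import all_classical.
Set Implicit Arguments.
Unset Strict Implicit.
Unset Printing Implicit Defensive.
Import GRing.Theory Quotient.
Local Open Scope classical_set_scope.
Local Open Scope ring_scope.
Local Open Scope quotient_scope.
Local Open Scope card_scope.

(* Abelian groups are zmodTypes; a subgroup of A is an H : zmodClosed A, with
   quotient group {quot H}.  Membership is boolean, but by classical logic
   every subgroup of A is of this form. *)

Definition prime_nat : Type := {p : nat | prime p}.

Definition zmod_prod (I : Type) (V : I -> zmodType) : Type := forall i, V i.

Section ZmodProd.
Variables (I : Type) (V : I -> zmodType).
Local Notation P := (zmod_prod V).

HB.instance Definition _ := gen_eqMixin P.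
HB.instance Definition _ := gen_choiceMixin P.

Let addp (f g : P) : P := fun i => f i + g i.
Let oppp (f : P) : P := fun i => - f i.
Let zerop : P := fun i => 0.

Fact zmod_prod_addA : associative addp.
Proof. by move=> f g h; apply: functional_extensionality_dep => i; exact: addrA. Qed.
Fact zmod_prod_addC : commutative addp.
Proof. by move=> f g; apply: functional_extensionality_dep => i; exact: addrC. Qed.
Fact zmod_prod_add0 : left_id zerop addp.
Proof. by move=> f; apply: functional_extensionality_dep => i; exact: add0r. Qed.
Fact zmod_prod_addN : left_inverse zerop oppp addp.
Proof. by move=> f; apply: functional_extensionality_dep => i; exact: addNr. Qed.

HB.instance Definition _ := GRing.isZmodule.Build P
  zmod_prod_addA zmod_prod_addC zmod_prod_add0 zmod_prod_addN.
End ZmodProd.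

Section AdditiveZmod.
Variables U V : zmodType.
Local Notation H := {additive U -> V}.

HB.instance Definition _ := gen_eqMixin H.
HB.instance Definition _ := gen_choiceMixin H.

Let addh (f g : H) : H := f \+ g.
Let opph (f : H) : H := \- f.
Let zeroh : H := \0.

Fact additive_ext (f g : H) : f =1 g -> f = g.
Proof.
case: f g => f [[Hf]] [g [[Hg]]] /funext /= fg.
by case: _ / fg Hg => Hg; rewrite (Prop_irrelevance Hf Hg).
Qed.

Fact additive_addA : associative addh.
Proof. by move=> f g h; apply: additive_ext => x; exact: addrA. Qed.
Fact additive_addC : commutative addh.
Proof. by move=> f g; apply: additive_ext => x; exact: addrC. Qed.
Fact additive_add0 : left_id zeroh addh.
Proof. by move=> f; apply: additive_ext => x; exact: add0r. Qed.
Fact additive_addN : left_inverse zeroh opph addh.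
Proof. by move=> f; apply: additive_ext => x; exact: addNr. Qed.

HB.instance Definition _ := GRing.isZmodule.Build H
  additive_addA additive_addC additive_add0 additive_addN.
End AdditiveZmod.

Notation endo A := {additive A -> A}.

Definition is_subgroup (V : zmodType) (S : set V) : Prop :=
  S 0 /\ forall x y, S x -> S y -> S (x - y).

Definition is_torsion_free (V : zmodType) (S : set V) : Prop :=
  forall x n, S x -> (0 < n)%N -> x *+ n = 0 -> x = 0.

Definition is_divisible (V : zmodType) (S : set V) : Prop :=
  forall x n, S x -> (0 < n)%N -> exists2 y, S y & y *+ n = x.

Definition torsion (A : zmodType) : {pred A} :=
  fun x => `[< exists2 n, (0 < n)%N & x *+ n = 0 >].

Fact torsion_zmod_closed (A : zmodType) : zmod_closed (@torsion A).
Proof.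
split=> [|x y]; first by apply/asboolP; exists 1%N.
move=> /asboolP[m m0 xm] /asboolP[n n0 yn]; apply/asboolP.
exists (m * n)%N; first by rewrite muln_gt0 m0.
by rewrite mulrnBl mulrnA xm mul0rn mulnC mulrnA yn mul0rn subr0.
Qed.

HB.instance Definition _ (A : zmodType) :=
  GRing.isZmodClosed.Build A (@torsion A) (@torsion_zmod_closed A).

Definition p_component (A : zmodType) (p : nat) : set A :=
  [set x | exists n, x *+ (p ^ n) = 0].
Arguments p_component A p : clear implicits.

Definition lin_indep (V : zmodType) (B : set V) : Prop :=
  forall (s : seq V) (c : V -> int), uniq s -> (forall x, x \in s -> B x) ->
    \sum_(x <- s) x *~ c x = 0 -> forall x, x \in s -> c x = 0.

Definition int_span (V : zmodType) (B : set V) : set V :=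
  [set y | exists (s : seq V) (c : V -> int),
     (forall x, x \in s -> B x) /\ y = \sum_(x <- s) x *~ c x].

Definition has_rank (V : zmodType) (n : nat) : Prop :=
  exists B : set V, [/\ B #= `I_n, lin_indep B &
    forall C : set V, B `<=` C -> lin_indep C -> C `<=` B].

Definition has_torsion_free_rank (A : zmodType) (n : nat) : Prop :=
  has_rank {quot @torsion A} n.

Definition free_abelian (A : zmodType) (F : zmodClosed A) : Prop :=
  exists B : set A, lin_indep B /\ [set` F] = int_span B.

(* A p-adic integer as an element of the inverse limit of the Z/p^n: the
   n-th term is the representative in [0, p^n) of its residue mod p^n. *)
Record padic_int (p : nat) := PadicInt {
  padic_res :> nat -> nat;
  padic_coherent : forall n, padic_res n = (padic_res n.+1 %% p ^ n)%N }.

Definition J : Type := forall p : prime_nat, padic_int (val p).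

(* K / H, as a subset of the quotient of the whole group *)
Definition quot_set (A : zmodType) (H : zmodClosed A) (K : set A) :
    set {quot H} := [set \pi_({quot H}) x | x in K].
Arguments quot_set {A} H K.

Definition inertial (A : zmodType) (phi : endo A) : Prop :=
  forall H : zmodClosed A,
    finite_set (quot_set H [set h + phi k | h in [set` H] & k in [set` H]]).

(* A p-adic integer a multiplies an element killed by p^n by the residue of a
   mod p^n; J acts on the p-component of a periodic group through its
   p-th coordinate, and such a group is the direct sum of its p-components. *)
Definition acts_as_mult (A : zmodType) (phi : endo A) (F A0 : zmodClosed A)
    (alpha : J) : Prop :=
  forall (p : prime_nat) (n : nat) (x : A), x \in A0 ->
    \pi_({quot F}) x *+ (val p ^ n) = 0 ->
    \pi_({quot F}) (phi x) = \pi_({quot F}) x *+ alpha p n.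

Definition invariant_under (A : zmodType) (phi : endo A) (H : zmodClosed A) :
    Prop := forall x, x \in H -> phi x \in H.

Definition uniform (A : zmodType) (phi : endo A) : Prop :=
  exists (F A0 : zmodClosed A) (alpha : J),
    [/\ {subset F <= A0}, invariant_under phi F, invariant_under phi A0 &
        finite_set (quot_set A0 [set: A])] /\
    [/\ forall y, quot_set F [set` A0] y -> y \in @torsion {quot F},
        acts_as_mult phi F A0 alpha,
        free_abelian F & forall x, x \in F -> phi x = 0].

Definition UI (A : zmodType) : set (endo A) :=
  [set phi | inertial phi /\ uniform phi].
Arguments UI A : clear implicits.

Definition annihilates_mod_torsion (A : zmodType) (phi : endo A) : Prop :=
  forall x, phi x \in @torsion A.

Definition annihilates_torsion (A : zmodType) (phi : endo A) : Prop :=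
  forall x, x \in @torsion A -> phi x = 0.

Definition finitary (A : zmodType) : {pred endo A} :=
  fun phi => `[< finite_set (range phi) >].

Fact finitary_zmod_closed (A : zmodType) : zmod_closed (@finitary A).
Proof.
split=> [|f g].
  apply/asboolP; apply: (@sub_finite_set _ _ [set 0]); last exact: finite_set1.
  by move=> _ [x _ <-].
move=> /asboolP ff /asboolP fg; apply/asboolP.
apply: (@sub_finite_set _ _ [set y - z | y in range f & z in range g]).
  by move=> _ [x _ <-]; exists (f x); [exists x|exists (g x); [exists x|]].
exact: finite_image2.
Qed.

HB.instance Definition _ (A : zmodType) :=
  GRing.isZmodClosed.Build (endo A) (@finitary A) (@finitary_zmod_closed A).

(* Main.v *)
Require Import Defs.
From HB Require Import structures.
From mathcomp Require Import all_boot all_order all_algebra.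
From mathcomp Require Import generic_quotient ring_quotient.
From mathcomp Require Import all_classical.
Set Implicit Arguments.
Unset Strict Implicit.
Unset Printing Implicit Defensive.
Import GRing.Theory Num.Theory Quotient.
Local Open Scope classical_set_scope.
Local Open Scope ring_scope.
Local Open Scope card_scope.

(** The group [A] consists of the pairs (r, f), r a rational number and f in
    the product of the Z/p, such that every prime divides the denominator of r
    at most once and f_p is the residue of r mod p for almost all p.  Its
    torsion subgroup T is given by r = 0: it is the direct sum of the Z/p, and
    A/T is the group of fractions with squarefree denominator.  Two kinds of
    elements matter: [base] = (1, 1, 1, ...) and, for each prime q,
    [base_over q], the quotient of [base] by q, with coordinate 0 at q.
    The extension does not split, because q times [base_over q] is [base] with
    its q-th coordinate erased: an element with a pole at q remembers the
    q-component of T.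

    For each q the group is generated by [base_over q], [base] and qA
    ([A_decomp]), and the coefficient of [base_over q] is the residue of r at
    its possible pole in q.  A homomorphism phi from A to T sends [base] to an
    element killed by some N > 0, and qA to elements with q-th coordinate 0.
    So for q prime to N the q-th coordinate of phi is a constant w_q times the
    residue at q ([coord_image]).  Conversely any family w of weights defines
    such a homomorphism [twist w], since an element has only finitely many
    poles.  The [twist w] are exactly the endomorphisms that kill T and have
    image in T ([twist_endo_range]), which is the isomorphism of X with the
    product of the Z/p; and every phi from A to T differs from the twist by its
    weights by an endomorphism killed by N, hence of finite image because only
    finitely many elements of A are killed by N.

    It remains to see that the uniform inertial endomorphisms are exactly the
    homomorphisms from A to T.  A uniform one kills a subgroup F with A/F
    periodic, so has image in T ([uniform_into_torsion]).  Let conversely phi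
    be as above.

    - phi is inertial ([inertial_into_torsion]).  Let a subgroup H contain a
      nonzero multiple of [base].  If h in H has a pole at q, a combination of
      h and [base] is a torsion element of H that does not vanish at q.  Up to
      finitely many primes, phi(h) lives at the poles of h, so by the Chinese
      remainder theorem it agrees with an element of H.

    - phi is uniform ([into_torsion_uniform]), with F generated by N base and
      A0 = NA.  For p prime to N, the p-component of A/F is cyclic of order
      p^2 generated by the image of [base_over p], whose multiple by -p
      generates the image of the p-component of T; so phi acts as
      multiplication by -p w_p.

    Finally an endomorphism with image in T is finitary if and only if some
    M > 0 kills it ([finitaryP]).  Torsion-freeness of the quotient follows at
    once, divisibility by dividing the weights at the primes where this is
    possible, and uncountability by a diagonal choice of the weights. *)

(** * Residues of rational numbers modulo primes *)

Definition to_prime_nat p (pr : prime p) : prime_nat := exist _ p pr.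

Lemma prime_nat_gt1 (q : prime_nat) : (1 < val q)%N.
Proof. exact: prime_gt1 (valP q). Qed.

Lemma prime_nat_gt0 (q : prime_nat) : (0 < val q)%N.
Proof. exact: prime_gt0 (valP q). Qed.

Lemma Zq_nat_eq0 (q : prime_nat) n :
  (n%:R == 0 :> 'Z_(val q)) = (val q %| n)%N.
Proof.
apply/esym/dvdn_pcharf; rewrite inE/= (valP q)/=.
by rewrite pchar_Zp ?prime_nat_gt1.
Qed.

Lemma Zq_char (q : prime_nat) : (val q)%:R = 0 :> 'Z_(val q).
Proof. by rewrite pchar_Zp ?prime_nat_gt1. Qed.

Lemma Zq_mulrn_char (q : prime_nat) (x : 'Z_(val q)) : x *+ val q = 0.
Proof. by rewrite -mulr_natr Zq_char mulr0. Qed.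

Lemma Zq_mulrn_dvd (q : prime_nat) (x : 'Z_(val q)) n :
  (val q %| n)%N -> x *+ n = 0.
Proof. by rewrite -Zq_nat_eq0 => /eqP n0; rewrite -mulr_natr n0 mulr0. Qed.

Lemma Zq_int_eq0 (q : prime_nat) (m : int) :
  (m%:~R == 0 :> 'Z_(val q)) = (val q %| `|m|)%N.
Proof. by case: m => n; rewrite ?NegzE ?rmorphN/= ?oppr_eq0 Zq_nat_eq0. Qed.

Lemma Zq_unit_nat (q : prime_nat) n :
  coprime (val q) n -> n%:R \is a @GRing.unit 'Z_(val q).
Proof. by move=> qn; rewrite unitZpE ?prime_nat_gt1. Qed.

Lemma Zq_mulrnI (q : prime_nat) n (x y : 'Z_(val q)) :
  coprime (val q) n -> x *+ n = y *+ n -> x = y.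
Proof.
by move=> /Zq_unit_nat u; rewrite -mulr_natr -[y *+ _]mulr_natr => /(mulIr u).
Qed.

Lemma Zq_unit (q : prime_nat) (x : 'Z_(val q)) : x != 0 -> x \is a GRing.unit.
Proof.
rewrite -[x]natr_Zp Zq_nat_eq0 => qx; apply: Zq_unit_nat.
by rewrite prime_coprime // (valP q).
Qed.

(** r lies in the localization of the integers at q.  A denominator k that need
    not be reduced makes the closure properties immediate. *)
Definition integral_at (q : nat) (r : rat) : Prop :=
  exists2 k, coprime q k & exists m : int, r *+ k = m%:~R.

Lemma coprime_integral_at q k (r : rat) (m : int) :
  coprime q k -> r *+ k = m%:~R -> integral_at q r.
Proof. by move=> qk e; exists k => //; exists m. Qed.

Lemma integral_at_int q (m : int) : integral_at q m%:~R.
Proof. by apply: (@coprime_integral_at q 1 _ m); rewrite ?coprimen1. Qed.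

Lemma integral_atB q r s :
  integral_at q r -> integral_at q s -> integral_at q (r - s).
Proof.
move=> [k qk [m e]] [l ql [n f]]; exists (k * l)%N; first by rewrite coprimeMr qk.
exists (m *+ l - n *+ k); rewrite mulrnBl rmorphB/= !rmorphMn/= -e -f.
by rewrite -!mulrnA [(l * k)%N]mulnC.
Qed.

Lemma mulrn_rat_cross (r : rat) k (m : int) :
  r *+ k = m%:~R -> numq r * k%:Z = m * denq r.
Proof.
move=> e; apply: (@intr_inj rat); rewrite !rmorphM/= -e.
by rewrite -{2}[r]divq_num_den mulrnAl divfK ?intr_eq0 ?denq_neq0// mulr_natr.
Qed.

Lemma denq_dvd (r : rat) k (m : int) :
  r *+ k = m%:~R -> (`|denq r| %| k)%N.
Proof.
move=> /mulrn_rat_cross/(congr1 absz); rewrite !abszM absz_nat => e.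
rewrite -(Gauss_dvdr k (_ : coprime _ `|numq r|)) ?e ?dvdn_mull//.
by rewrite coprime_sym coprime_num_den.
Qed.

Lemma integral_at_denq q r : integral_at q r -> coprime q `|denq r|.
Proof. by move=> [k qk [m /denq_dvd /coprime_dvdr]]; apply. Qed.

(** A prime factor of the reduced denominator would contradict integrality at
    that prime. *)
Lemma integral_everywhere r :
  (forall q : prime_nat, integral_at (val q) r) -> exists m : int, r = m%:~R.
Proof.
move=> rZ; suff d1 : `|denq r|%N = 1%N.
  exists (numq r); rewrite -{1}[r]divq_num_den.
  by rewrite -(gtz0_abs (denq_gt0 r)) d1 divr1.
apply/eqP; rewrite -dvdn1; apply/contraT => d1.
have pr : prime (pdiv `|denq r|).
  by apply: pdiv_prime; rewrite ltn_neqAle eq_sym -dvdn1 d1 absz_gt0 denq_neq0.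
have := integral_at_denq (rZ (to_prime_nat pr)).
by rewrite prime_coprime //= pdiv_dvd.
Qed.

(** Reduction mod q of a q-integral rational.  [ratr] inverts the image of the
    reduced denominator, which is a unit as it divides k. *)
Lemma Zq_ratr (q : prime_nat) k (r : rat) (m : int) :
  coprime (val q) k -> r *+ k = m%:~R -> ratr r *+ k = m%:~R :> 'Z_(val q).
Proof.
move=> qk e; have dk := denq_dvd e; have qd := coprime_dvdr dk qk.
have du : (denq r)%:~R \is a @GRing.unit 'Z_(val q).
  by rewrite -(gtz0_abs (denq_gt0 r)); apply: Zq_unit_nat.
apply: (mulIr du); rewrite /ratr mulrnAl mulrVK// -rmorphM/= -(mulrn_rat_cross e) rmorphM/=.
by rewrite mulr_natr.
Qed.

Lemma Zq_ratrB (q : prime_nat) r s :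
  integral_at (val q) r -> integral_at (val q) s ->
  ratr (r - s) = ratr r - ratr s :> 'Z_(val q).
Proof.
move=> [k qk [m e]] [l ql [n f]].
apply: (@Zq_mulrnI _ (k * l)%N); first by rewrite coprimeMr qk.
rewrite (@Zq_ratr q (k * l) _ (m *+ l - n *+ k)) ?coprimeMr ?qk//.
  rewrite rmorphB !rmorphMn/= mulrnBl.
  by rewrite -(Zq_ratr qk e) -(Zq_ratr ql f) -!mulrnA [(l * k)%N]mulnC.
rewrite mulrnBl rmorphB/= !rmorphMn/= -e -f.
by rewrite -!mulrnA [(l * k)%N]mulnC.
Qed.

(** * The group *)

Definition Zprod : zmodType :=
  zmod_prod (fun q : prime_nat => 'Z_(val q) : zmodType).

(** f_q is the residue of r for almost all q; the finite set of exceptions is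
    encoded as the set of prime factors of n. *)
Definition is_shadow (r : rat) (f : Zprod) : Prop :=
  exists2 n, (0 < n)%N & exists2 m : int, r *+ n = m%:~R &
    forall q : prime_nat, coprime (val q) n -> f q *+ n = m%:~R.

Definition simple_poles (r : rat) : Prop :=
  forall q : prime_nat, integral_at (val q) (r *+ val q).

Definition mixed_group : {pred rat * Zprod} :=
  fun x => `[< simple_poles x.1 /\ is_shadow x.1 x.2 >].

Fact mixed_group_zmod_closed : zmod_closed mixed_group.
Proof.
split=> [|[r f] [s g]].
  apply/asboolP; split=> [q|]; first by rewrite mul0rn; exact: (integral_at_int _ 0).
  by exists 1%N => //; exists 0 => // q _; rewrite mul0rn.
move=> /asboolP[/= rP [k k0 [m e fP]]] /asboolP[/= sP [l l0 [n h gP]]].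
apply/asboolP; split=> [q|/=].
  by rewrite mulrnBl; apply: integral_atB.
exists (k * l)%N; first by rewrite muln_gt0 k0.
exists (m *+ l - n *+ k) => [|q].
  rewrite mulrnBl rmorphB/= !rmorphMn/= -e -h.
  by rewrite -!mulrnA [(l * k)%N]mulnC.
rewrite coprimeMr => /andP[qk ql].
rewrite mulrnBl rmorphB/= !rmorphMn/= -fP// -gP//.
by rewrite -!mulrnA [(l * k)%N]mulnC.
Qed.

HB.instance Definition _ :=
  GRing.isZmodClosed.Build (rat * Zprod)%type mixed_group mixed_group_zmod_closed.

Definition A : Type := {x : rat * Zprod | x \in mixed_group}.
HB.instance Definition _ := Choice.on A.
HB.instance Definition _ := SubType.on A.
HB.instance Definition _ := [SubChoice_isSubZmodule of A by <:].

Definition slope (x : A) : rat := (val x).1.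
Definition coord (q : prime_nat) (x : A) : 'Z_(val q) := (val x).2 q.

Fact slope_is_zmod_morphism : zmod_morphism slope.
Proof. by move=> x y; rewrite /slope raddfB. Qed.
HB.instance Definition _ :=
  GRing.isZmodMorphism.Build A rat slope slope_is_zmod_morphism.

Fact coord_is_zmod_morphism q : zmod_morphism (coord q).
Proof. by move=> x y; rewrite /coord raddfB. Qed.
HB.instance Definition _ q :=
  GRing.isZmodMorphism.Build A 'Z_(val q) (coord q) (coord_is_zmod_morphism q).

Lemma A_ext (x y : A) :
  slope x = slope y -> (forall q, coord q x = coord q y) -> x = y.
Proof.
move=> r e; apply/val_inj; rewrite [val x]surjective_pairing.
rewrite [val y]surjective_pairing; congr (_, _) => //.
exact: functional_extensionality_dep.
Qed.

Lemma slope_simple_poles x : simple_poles (slope x).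
Proof. by case/asboolP: (valP x). Qed.

Lemma coord_shadow (x : A) : exists2 n, (0 < n)%N &
  exists2 m : int, slope x *+ n = m%:~R &
    forall q, coprime (val q) n -> coord q x *+ n = m%:~R.
Proof. by case/asboolP: (valP x). Qed.

Lemma A_intro r (f : Zprod) : simple_poles r -> is_shadow r f ->
  {x : A | slope x = r & forall q, coord q x = f q}.
Proof.
move=> rP fP.
have xA : (r, f) \in mixed_group by apply/asboolP.
by exists (Sub (r, f) xA); rewrite /slope /coord SubK.
Qed.

Lemma base_spec : {x : A | slope x = 1 & forall q, coord q x = 1}.
Proof.
apply: (@A_intro 1 (fun q => 1)) => [q|].
  by rewrite -[1 *+ _]/((val q : int)%:~R); exact: integral_at_int.
by exists 1%N => //; exists 1.
Qed.

Definition base : A := sval base_spec.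

Lemma slope_base : slope base = 1.
Proof. by rewrite /base; case: base_spec. Qed.

Lemma coord_base q : coord q base = 1.
Proof. by rewrite /base; case: base_spec. Qed.

(** * Division by a prime *)

Lemma Zq_invn (q : prime_nat) n : coprime (val q) n ->
  (n%:R)^-1 *+ n = 1 :> 'Z_(val q).
Proof. by move=> /Zq_unit_nat u; rewrite -[LHS]mulr_natr mulVr. Qed.

Lemma rat_divnK (q : prime_nat) (r : rat) : r / (val q)%:R *+ val q = r.
Proof.
by rewrite -[LHS]mulr_natr divfK// pnatr_eq0 -lt0n prime_nat_gt0.
Qed.

Lemma prime_nat_coprime (p q : prime_nat) : p != q -> coprime (val p) (val q).
Proof.
by move=> pq; rewrite prime_coprime ?(valP p)// dvdn_prime2 ?(valP p) ?(valP q).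
Qed.

(** The quotient of x by q.  At p = q the formula gives coordinate 0, because
    q vanishes in Z/q and the inverse of 0 is 0.  Integrality of the slope
    at q is what keeps the pole of the quotient simple. *)
Lemma A_div (q : prime_nat) (x : A) : integral_at (val q) (slope x) ->
  {y : A | slope y = slope x / (val q)%:R &
    forall p, coord p y = coord p x * ((val q)%:R)^-1}.
Proof.
move=> xq; apply: A_intro => [p|].
  have [->|pq] := eqVneq p q.
    by rewrite rat_divnK.
  have [k pk [m e]] := slope_simple_poles x p.
  apply: (@coprime_integral_at _ (k * val q) _ m); first by rewrite coprimeMr pk prime_nat_coprime.
  rewrite -e [(k * _)%N]mulnC mulrnA; congr (_ *+ k).
  by rewrite mulrnAC rat_divnK.
have [n n0 [m e xm]] := coord_shadow x.
exists (n * val q)%N; first by rewrite muln_gt0 n0 prime_nat_gt0.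
exists m => [|p].
  rewrite -e mulnC mulrnA; congr (_ *+ _).
  exact: rat_divnK.
rewrite coprimeMr => /andP[pn pq]; rewrite -xm// mulnC mulrnA; congr (_ *+ _).
by rewrite -mulrnAr Zq_invn// mulr1.
Qed.

Lemma A_divK (q : prime_nat) (x : A) :
  integral_at (val q) (slope x) -> coord q x = 0 -> exists y : A, x = y *+ val q.
Proof.
move=> xq x0; have [y ys yc] := A_div xq; exists y; apply: A_ext => [|p].
  by rewrite raddfMn/= ys rat_divnK.
rewrite raddfMn/= yc; have [->|pq] := eqVneq p q; first by rewrite x0 mul0r mul0rn.
by rewrite -mulrnAr Zq_invn ?mulr1// prime_nat_coprime.
Qed.

Lemma base_integral q : integral_at q (slope base).
Proof. by rewrite slope_base; exact: (integral_at_int _ 1). Qed.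

Definition base_over (q : prime_nat) : A := s2val (A_div (base_integral (val q))).

Lemma slope_base_over q : slope (base_over q) = (val q)%:R^-1.
Proof. by rewrite /base_over; case: A_div => y /= -> _; rewrite slope_base div1r. Qed.

(** The residue of the slope at its possible pole in q, as for meromorphic
    functions. *)
Definition residue (q : prime_nat) (x : A) : 'Z_(val q) := ratr (slope x *+ val q).

Fact residue_is_zmod_morphism q : zmod_morphism (residue q).
Proof.
by move=> x y; rewrite /residue raddfB/= mulrnBl Zq_ratrB//; exact: slope_simple_poles.
Qed.
HB.instance Definition _ q := GRing.isZmodMorphism.Build A 'Z_(val q)
  (residue q) (residue_is_zmod_morphism q).

Lemma residue_base_over q : residue q (base_over q) = 1.
Proof.
rewrite /residue slope_base_over -[_^-1]mul1r rat_divnK.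
exact: (@ratr_int 'Z_(val q) 1).
Qed.

Lemma residue_eq0 q x : residue q x = 0 <-> integral_at (val q) (slope x).
Proof.
split=> [x0|[k qk [m e]]].
  have [k qk [m e]] := slope_simple_poles x q.
  have := Zq_ratr qk e; rewrite -/(residue q x) x0 mul0rn => /esym/eqP.
  rewrite Zq_int_eq0 => /dvdnP[j mj].
  have [j' mj'] : exists j' : int, m = j' *+ val q.
    exists (sgz m * j); rewrite {1}[m]intEsg mj PoszM mulrA.
    by rewrite -mulr_natr natz.
  apply: (@coprime_integral_at _ k _ j') => //.
  have q0 : ((val q)%:R : rat) != 0 by rewrite pnatr_eq0 -lt0n prime_nat_gt0.
  apply: (mulIf q0); rewrite !mulr_natr mulrnAC e mj' rmorphMn//.
apply: (@Zq_mulrnI _ k) => //.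
rewrite mul0rn (Zq_ratr qk (_ : _ = (m *+ val q)%:~R)).
  by rewrite rmorphMn/= Zq_mulrn_char.
by rewrite mulrnAC e rmorphMn.
Qed.

Lemma residue_torsion q (x : A) : slope x = 0 -> residue q x = 0.
Proof. by move=> x0; apply/residue_eq0; rewrite x0; exact: (integral_at_int _ 0). Qed.

Lemma residue_base q : residue q base = 0.
Proof. by apply/residue_eq0; exact: base_integral. Qed.

Lemma Zq_repr (q : prime_nat) (x : 'Z_(val q)) :
  exists2 k, (k < val q)%N & x = k%:R.
Proof.
exists x; last by rewrite natr_Zp.
by rewrite -[ltnRHS](Zp_cast (prime_nat_gt1 q)).
Qed.

(** Subtracting a multiple of [base_over q] removes the pole at q, and then a
    multiple of [base] removes the coordinate at q; what is left is divisible
    by q. *)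
Lemma A_decomp (q : prime_nat) (x : A) :
  exists k j, exists y, [/\ (k < val q)%N, (j < val q)%N, residue q x = k%:R &
    x = base_over q *+ k + base *+ j + y *+ val q].
Proof.
have [k kq ek] := Zq_repr (residue q x).
have [j jq ej] := Zq_repr (coord q (x - base_over q *+ k)).
have [||y e] := @A_divK q (x - base_over q *+ k - base *+ j).
- apply/residue_eq0; rewrite !raddfB !raddfMn/= residue_base_over residue_base.
  by rewrite oppr0 mul0rn addr0 ek mulNrn subrr.
- by rewrite raddfB/= ej raddfMn/= coord_base subrr.
exists k, j, y; split=> //; rewrite -e.
by rewrite [RHS]addrC [X in _ = _ + X]addrC addrA !subrK.
Qed.

(** Where f_q is the residue of r = 0, it vanishes; the remaining coordinates
    are killed by their primes. *)
Lemma torsionP (x : A) : x \in @torsion A <-> slope x = 0.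
Proof.
split=> [/asboolP[n n0 /(congr1 slope)]|x0].
  rewrite raddfMn raddf0/= => /eqP; rewrite mulrn_eq0 => /orP[|/eqP//].
  by rewrite eqn0Ngt n0.
have [n n0 [m]] := coord_shadow x; rewrite x0 mul0rn => e xm.
have m0 : m = 0 by apply: (@intr_inj rat); rewrite -e.
apply/asboolP; exists n => //; apply: A_ext => [|q].
  by rewrite raddfMn/= x0 mul0rn raddf0.
rewrite raddfMn/= raddf0; have [/xm->|] := boolP (coprime (val q) n).
  by rewrite m0.
by rewrite prime_coprime ?(valP q)// negbK; exact: Zq_mulrn_dvd.
Qed.

(** If n witnesses [is_shadow], one factor n clears the denominator and a second
    one kills the exceptional coordinates, so n ^ 2 works. *)
Lemma multiple_base (x : A) : exists2 n, (0 < n)%N &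
  exists m : int, x *+ n = base *~ m.
Proof.
have [n n0 [m e xm]] := coord_shadow x.
exists (n * n)%N; first by rewrite muln_gt0 n0.
exists (m *+ n); apply: A_ext => [|q].
  rewrite raddfMn raddfMz/= slope_base mulrnA e -rmorphMn/=.
  by rewrite -[RHS]mulrzr mul1r.
rewrite raddfMn raddfMz/= coord_base mulrnA rmorphMn/=.
have [/xm->//|] := boolP (coprime (val q) n).
by rewrite prime_coprime ?(valP q)// negbK => qn; rewrite !Zq_mulrn_dvd.
Qed.

(** * Torsion elements *)

Lemma pi_eq (V : zmodType) (H : zmodClosed V) (x y : V) :
  \pi_({quot H})%qT x = \pi_({quot H})%qT y <-> x - y \in H.
Proof. by rewrite idealrBE; split=> [->|/eqP]. Qed.

Lemma pi_eq0 (V : zmodType) (H : zmodClosed V) (x : V) :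
  \pi_({quot H})%qT x = 0 <-> x \in H.
Proof. by have := pi_eq H x 0; rewrite subr0 raddf0. Qed.

(** Extension of [coord] to all natural indices, so that finitely many coordinates
    form a function on an ordinal type. *)
Definition nat_coord (n : nat) (x : A) : nat :=
  if (insub n : option prime_nat) is Some q then coord q x : nat else 0%N.

Lemma nat_coordE (q : prime_nat) x : nat_coord (val q) x = coord q x.
Proof. by rewrite /nat_coord valK. Qed.

Lemma coord_killed q (x : A) n :
  coprime (val q) n -> x *+ n = 0 -> coord q x = 0.
Proof.
move=> qn /(congr1 (coord q)); rewrite raddfMn raddf0/= => e.
by apply: (Zq_mulrnI qn); rewrite e mul0rn.
Qed.

Lemma killedP (x : A) n : (0 < n)%N -> slope x = 0 ->
  (forall q, coprime (val q) n -> coord q x = 0) -> x *+ n = 0.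
Proof.
move=> n0 x0 xn; apply: A_ext => [|q]; rewrite raddfMn raddf0/= ?x0 ?mul0rn//.
have [/xn->|] := boolP (coprime (val q) n); first by rewrite mul0rn.
by rewrite prime_coprime ?(valP q)// negbK; exact: Zq_mulrn_dvd.
Qed.

Lemma killed_torsion (x : A) n : (0 < n)%N -> x *+ n = 0 -> slope x = 0.
Proof. by move=> n0 xn; apply/torsionP/asboolP; exists n. Qed.

(** Such an element is determined by its coordinates at the primes up to n. *)
Lemma finite_killed n : (0 < n)%N -> finite_set [set x : A | x *+ n = 0].
Proof.
move=> n0; set S := [set x : A | _].
pose g (x : A) := [ffun i : 'I_n.+1 => (inord (nat_coord i x) : 'I_n.+1)].
suff gI : {in S &, injective g}.
  by rewrite -(eq_finite_set (inj_card_eq gI)); exact: finite_finset.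
move=> x y /set_mem xn /set_mem yn gxy; apply: A_ext => [|q].
  by rewrite !(killed_torsion n0).
have [qn|] := boolP (coprime (val q) n); first by rewrite !(coord_killed qn).
rewrite prime_coprime ?(valP q)// negbK => /(dvdn_leq n0) qn.
have iq : (inord (val q) : 'I_n.+1) = val q :> nat by rewrite inordK.
have /(congr1 (@nat_of_ord _)) : g x (inord (val q)) = g y (inord (val q)) by rewrite gxy.
rewrite !ffunE iq !nat_coordE.
have lt z : (coord q z < n.+1)%N.
  have := ltn_ord (coord q z); rewrite [X in (_ < X)%N](Zp_cast (prime_nat_gt1 q)).
  by move=> /leq_trans; apply; exact: leqW.
by rewrite !inordK ?lt// => /val_inj.
Qed.

Lemma coprime_fact_lt p n : prime p -> (n < p)%N -> coprime p n`!.
Proof.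
move=> pr; elim: n => [|n IH] np; first by rewrite coprimen1.
by rewrite factS coprimeMr IH ?(ltnW np)// prime_coprime// gtnNdvd.
Qed.

Lemma coord_large_torsion (g : A) : g \in @torsion A ->
  exists B, forall q, (B <= val q)%N -> coord q g = 0.
Proof.
move=> /asboolP[n n0 gn]; exists n.+1 => q nq; apply: (coord_killed _ gn).
by rewrite prime_coprime ?(valP q)// gtnNdvd.
Qed.

(** Chinese remainder theorem: if t vanishes wherever g does, the congruences
    k g_q = t_q are solvable together.  They are solved prime by prime, which
    ends since g has finite support. *)
Lemma simultaneous_multiple (P : pred prime_nat) (g t : A) :
  g \in @torsion A ->
  (forall q, P q -> coord q g = 0 -> coord q t = 0) ->
  exists k, forall q, P q -> coord q g *+ k = coord q t.
Proof.
move=> /coord_large_torsion[B gB] gt.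
suff [k kP] : exists k, forall q, (val q < B)%N -> P q -> coord q g *+ k = coord q t.
  exists k => q Pq; have [/kP->//|Bq] := ltnP (val q) B.
  by rewrite (gt q)// gB// mul0rn.
elim: {gB}B => [|B [k kP]]; first by exists 0%N.
have [pr|nB] := boolP (prime B); last first.
  exists k => q; rewrite ltnS leq_eqVlt => /predU1P[e|/kP//].
  by case/negP: nB; rewrite -e; exact: valP q.
set q0 := to_prime_nat pr.
have q0fact : coprime (val q0) (B.-1)`!.
  by apply: coprime_fact_lt; rewrite //= prednK// prime_gt0.
(* Multiples of (B - 1)! are 0 modulo the primes below B, so adding them to k
   keeps the congruences that k already solves. *)
have [j jP] : exists j, P q0 -> coord q0 g *+ (k + (B.-1)`! * j) = coord q0 t.
  have [g0|g0] := eqVneq (coord q0 g) 0.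
    by exists 0%N => Pq; rewrite g0 mul0rn gt.
  have u : coord q0 g *+ (B.-1)`! \is a GRing.unit.
    rewrite Zq_unit//; apply: contra g0 => /eqP e; apply/eqP.
    by apply: (Zq_mulrnI q0fact); rewrite e mul0rn.
  have [j _ e] :=
    Zq_repr ((coord q0 g *+ (B.-1)`!)^-1 * (coord q0 t - coord q0 g *+ k)).
  by exists j => _; rewrite mulrnDr mulrnA -[_ *+ j]mulr_natr -e mulVKr// addrC subrK.
exists (k + (B.-1)`! * j)%N => q; rewrite ltnS leq_eqVlt => /predU1P[e|qB] Pq.
  have qq0 : q = q0 by apply: val_inj.
  by rewrite qq0 in Pq *; exact: jP.
rewrite mulrnDr kP// mulrnA [_ *+ (B.-1)`!]Zq_mulrn_dvd ?mul0rn ?addr0//.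
by rewrite dvdn_fact// prime_nat_gt0/= -ltnS prednK// (leq_trans _ qB).
Qed.

(** * Endomorphisms with image in the torsion subgroup *)

Section IntoTorsion.
Variable phi : endo A.

Lemma base_image_killed : annihilates_mod_torsion phi ->
  exists2 N, (0 < N)%N & phi base *+ N = 0.
Proof. by move=> /(_ base)/asboolP. Qed.

(** By [A_decomp], modulo qA and up to a multiple of [base], x is a multiple of
    [base_over q] by its residue; both qA and [base] go to elements with zero
    q-th coordinate. *)
Lemma coord_image N q x : phi base *+ N = 0 -> coprime (val q) N ->
  coord q (phi x) = coord q (phi (base_over q)) * residue q x.
Proof.
move=> N0 qN; have [k [j [y [_ _ -> {1}->]]]] := A_decomp q x.
rewrite !raddfD/= !raddfMn/= (coord_killed qN N0) mul0rn addr0 Zq_mulrn_char addr0.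
by rewrite mulr_natr.
Qed.

(** A finite set of torsion elements has a common exponent, and conversely A has
    only finitely many elements of a given exponent. *)
Lemma finitaryP : annihilates_mod_torsion phi ->
  phi \in @finitary A <-> exists2 M, (0 < M)%N & forall x, phi x *+ M = 0.
Proof.
move=> phiT; split=> [/asboolP/finite_seqP[s es]|[M M0 phiM]]; last first.
  by apply/asboolP/(sub_finite_set _ (finite_killed M0)) => _ [x _ <-]; exact: phiM.
have sT y : y \in s -> y \in @torsion A.
  by move=> ys; have [x _ <-] : range phi y; [rewrite es|exact: phiT].
suff [M M0 MP] : exists2 M, (0 < M)%N & forall y, y \in s -> y *+ M = 0.
  by exists M => // x; apply: MP; have : range phi (phi x); [exists x|rewrite es].
elim: {es}s sT => [|a s IH] sT; first by exists 1%N.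
have [M M0 MP] := IH (fun y ys => sT y (@mem_behead _ (a :: s) y ys)).
have /asboolP[n n0 an] := sT a (mem_head a s).
exists (M * n)%N; first by rewrite muln_gt0 M0.
move=> y; rewrite inE => /predU1P[->|/MP yM]; last by rewrite mulrnA yM mul0rn.
by rewrite mulnC mulrnA an mul0rn.
Qed.

(** For every h in H, phi(h) is congruent modulo H to an element killed by a
    fixed M.  If H is periodic, M = N works, as elements of T have no poles.
    Otherwise H contains some [base *+ n] with n > 0, and M = N n. *)
Lemma inertial_into_torsion : annihilates_mod_torsion phi -> inertial phi.
Proof.
move=> phiT H; have [N N0 phiN] := base_image_killed phiT.
suff [M M0 MP] : exists2 M, (0 < M)%N & forall h, h \in H ->
    exists2 w, w \in H & (phi h - w) *+ M = 0.
  apply: (sub_finite_set _ (finite_image \pi_({quot H})%qT (finite_killed M0))).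
  move=> _ [_ [h hH [k kH <-]] <-]; have [w wH wM] := MP k kH.
  exists (phi k - w) => //; apply/pi_eq.
  by rewrite [h + _]addrC opprD addrA [phi k - w]addrC addrK -opprD rpredN rpredD.
have [[h0 h0H s0]|Hs] := pselect (exists2 h, h \in H & slope h != 0); last first.
  exists N => // h hH; exists 0; rewrite ?rpred0// subr0.
  have h0 : slope h = 0 by apply/eqP/negPn/negP => h0; apply: Hs; exists h.
  apply: killedP => // [|q qN]; first by apply/torsionP; exact: phiT.
  by rewrite (coord_image _ phiN)// residue_torsion// mulr0.
have [n n0 nH] : exists2 n, (0 < n)%N & base *+ n \in H.
  have [n n0 [m e]] := multiple_base h0.
  have m0 : m != 0.
    apply: contra s0 => /eqP m0; move/(congr1 slope): e; rewrite m0 mulr0z.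
    by rewrite raddfMn raddf0/= => /eqP; rewrite mulrn_eq0 eqn0Ngt n0.
  exists `|m|%N; first by rewrite absz_gt0.
  rewrite -[_ *+ _]/(base *~ `|m|%N) abszEsg mulrC mulrzA rpredMz//.
  by rewrite -e rpredMn.
exists (N * n)%N => [|h hH]; first by rewrite muln_gt0 N0.
set d := `|denq (slope h)|%N; set e := numq (slope h).
have hde : slope h *+ d = e%:~R.
  rewrite -{1}[slope h]divq_num_den -mulr_natr.
  by rewrite -[d%:R]/((d : int)%:~R) gtz0_abs ?denq_gt0// divfK// intr_eq0 denq_neq0.
(* g is torsion, lies in H, and does not vanish at the poles of h off n: there
   its coordinate is - n e, and e is prime to the denominator d. *)
set g := (h *+ d - base *~ e) *+ n.
have gH : g \in H.
  rewrite /g mulrnBl; apply: rpredB; first by rewrite !rpredMn.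
  by rewrite pmulrn mulrzAC -pmulrn rpredMz.
have gT : g \in @torsion A.
  apply/torsionP; rewrite raddfMn raddfB raddfMn raddfMz/= hde slope_base.
  by rewrite subrr mul0rn.
have [|k kP] := @simultaneous_multiple (fun q => coprime (val q) (N * n)) g (phi h) gT.
  move=> q; rewrite coprimeMr => /andP[qN qn] gq.
  rewrite (coord_image _ phiN)// (_ : residue q h = 0) ?mulr0//.
  apply/residue_eq0; have [qd|qd] := boolP (coprime (val q) d).
    exact: (coprime_integral_at qd hde).
  have q_d : (val q %| d)%N by apply: contraNT qd; rewrite prime_coprime ?(valP q).
  move: gq; rewrite raddfMn raddfB raddfMn raddfMz/= coord_base [coord q h *+ d]Zq_mulrn_dvd//.
  rewrite sub0r => ge; have/eqP : (e%:~R : 'Z_(val q)) = 0.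
    by apply/oppr_inj/(Zq_mulrnI qn); rewrite ge oppr0 mul0rn.
  rewrite Zq_int_eq0 => q_e; have := coprime_dvdl q_e (coprime_num_den (slope h)).
  by rewrite prime_coprime ?(valP q)// q_d.
clearbody g; exists (g *+ k); first by rewrite rpredMn.
apply: killedP; first by rewrite muln_gt0 N0.
  rewrite raddfB raddfMn/=; have /torsionP -> := gT; have /torsionP -> := phiT h.
  by rewrite mul0rn subr0.
by move=> q /kP; rewrite raddfB raddfMn/= => ->; rewrite subrr.
Qed.
End IntoTorsion.

(** * Twists *)

Lemma residue_eq0_large (x : A) : exists2 n, (0 < n)%N &
  forall q, coprime (val q) n -> residue q x = 0.
Proof.
have [n n0 [m e _]] := coord_shadow x; exists n => // q qn.
by apply/residue_eq0; exact: (coprime_integral_at qn e).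
Qed.

Lemma twist_spec (a : Zprod) (x : A) :
  {y : A | slope y = 0 & forall q, coord q y = a q * residue q x}.
Proof.
apply: (@A_intro 0 (fun q => a q * residue q x)) => [q|].
  by rewrite mul0rn; exact: (integral_at_int _ 0).
have [n n0 nx] := residue_eq0_large x.
exists n => //; exists 0 => [|q /nx->]; first exact: mul0rn.
by rewrite mulr0 mul0rn.
Qed.

(** Well defined because a slope has finitely many poles. *)
Definition twist (a : Zprod) (x : A) : A := s2val (twist_spec a x).

Lemma slope_twist a x : slope (twist a x) = 0.
Proof. by rewrite /twist; case: twist_spec. Qed.

Lemma coord_twist a x q : coord q (twist a x) = a q * residue q x.
Proof. by rewrite /twist; case: twist_spec. Qed.

Fact twist_is_zmod_morphism a : zmod_morphism (twist a).
Proof.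
move=> x y; apply: A_ext => [|q].
  by rewrite raddfB/= !slope_twist subr0.
by rewrite raddfB/= !coord_twist -mulrBr raddfB.
Qed.
HB.instance Definition _ a := GRing.isZmodMorphism.Build A A
  (twist a) (twist_is_zmod_morphism a).

Definition twist_endo (a : Zprod) : endo A := twist a.

Fact twist_endo_is_zmod_morphism : zmod_morphism twist_endo.
Proof.
move=> a b; apply: additive_ext => x.
rewrite -[RHS]/(twist a x - twist b x) /twist_endo/=.
apply: A_ext => [|q]; first by rewrite raddfB/= !slope_twist subr0.
rewrite raddfB/= !coord_twist -mulrBl; congr (_ * _).
Qed.
HB.instance Definition _ := GRing.isZmodMorphism.Build Zprod (endo A)
  twist_endo twist_endo_is_zmod_morphism.

Lemma coord_twist_over a q : coord q (twist a (base_over q)) = a q.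
Proof. by rewrite coord_twist residue_base_over mulr1. Qed.

Lemma twist_endo_inj : injective twist_endo.
Proof.
move=> a b ab; apply: functional_extensionality_dep => q.
have := congr1 (fun phi : endo A => coord q (phi (base_over q))) ab.
by rewrite /= !coord_twist_over.
Qed.

Lemma twist_annihilates_mod_torsion a : annihilates_mod_torsion (twist_endo a).
Proof. by move=> x; apply/torsionP; exact: slope_twist. Qed.

(** Evaluation at [base_over q] recovers w_q from [twist w], so these are the
    only possible weights of a twist close to phi. *)
Definition weights (phi : endo A) : Zprod := fun q => coord q (phi (base_over q)).

Lemma coord_twist_weights (phi : endo A) N q x :
  phi base *+ N = 0 -> coprime (val q) N ->
  coord q (twist (weights phi) x) = coord q (phi x).
Proof. by move=> N0 qN; rewrite coord_twist (coord_image _ N0). Qed.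

(** If phi also kills T, then phi(base) = 0, so that [coord_image] applies at all
    primes: [base] and q [base_over q] differ by torsion, so that phi(base) is
    divisible by q in T, hence zero at q, for each q. *)
Lemma twist_endo_range :
  range twist_endo =
  [set phi : endo A | annihilates_mod_torsion phi /\ annihilates_torsion phi].
Proof.
apply/seteqP; split=> [_ [a _ <-]|phi [phiT phi0]]/=.
  split=> [|x /torsionP x0]; first exact: twist_annihilates_mod_torsion.
  apply: A_ext => [|q]; first by rewrite slope_twist raddf0.
  by rewrite coord_twist residue_torsion// mulr0 raddf0.
exists (weights phi) => //; apply: additive_ext => x; apply: A_ext => [|q].
  by rewrite slope_twist; apply/esym/torsionP.
rewrite (@coord_twist_weights _ 1)// ?coprimen1// mulr1n.
apply: A_ext => [|q']; first by rewrite raddf0; apply/torsionP.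
have dT : base - base_over q' *+ val q' \in @torsion A.
  apply/torsionP; rewrite raddfB raddfMn/= slope_base slope_base_over.
  by rewrite -[_^-1]mul1r rat_divnK subrr.
have := phi0 _ dT; rewrite raddfB raddfMn/= => /eqP; rewrite subr_eq0 => /eqP->.
by rewrite raddfMn/= Zq_mulrn_char raddf0.
Qed.

Lemma endoMn (phi : endo A) n x : (phi *+ n) x = phi x *+ n.
Proof. by elim: n => // n IH; rewrite !mulrS -IH. Qed.

Definition into_torsion : set (endo A) := [set phi | annihilates_mod_torsion phi].

Lemma into_torsionB (phi psi : endo A) :
  into_torsion phi -> into_torsion psi -> into_torsion (phi - psi).
Proof. by move=> phiT psiT x; rewrite rpredB. Qed.

Lemma into_torsionMn (phi : endo A) n : into_torsion phi -> into_torsion (phi *+ n).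
Proof. by move=> phiT x; rewrite endoMn rpredMn. Qed.

(** Pigeonhole principle, to get exponents out of finiteness assumptions. *)
Lemma finite_repeat (T : Type) (S : set T) (u : nat -> T) :
  finite_set S -> (forall n, S (u n)) -> exists m n, (m < n)%N /\ u m = u n.
Proof.
move=> finS uS; apply: contrapT => no; apply: infinite_nat.
have uI : {in [set: nat] &, injective u}.
  move=> m n _ _ umn; have [mn|nm|//] := ltngtP m n; case: no.
    by exists m, n.
  by exists n, m.
rewrite -(eq_finite_set (inj_card_eq uI)).
by apply: sub_finite_set finS => _ [n _ <-].
Qed.

Lemma finitary_into_torsion (phi : endo A) : phi \in @finitary A -> into_torsion phi.
Proof.
move=> /asboolP fphi x.
have [|m [n [mn]]] := finite_repeat (u := fun n => phi (x *+ n)) fphi.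
  by move=> n; exists (x *+ n).
rewrite !raddfMn => e; apply/asboolP; exists (n - m)%N; first by rewrite subn_gt0.
by rewrite mulrnBr ?(ltnW mn)// e subrr.
Qed.

(** phi differs from the twist by its weights only at the primes dividing N. *)
Lemma into_torsion_decomp :
  into_torsion = [set xi + eta | xi in range twist_endo & eta in [set` @finitary A]].
Proof.
apply/seteqP; split=> [phi phiT|_ [_ [a _ <-] [eta etaF <-]] x].
  exists (twist_endo (weights phi)); first by exists (weights phi).
  have dT := into_torsionB phiT (@twist_annihilates_mod_torsion (weights phi)).
  exists (phi - twist_endo (weights phi)); last by rewrite addrC subrK.
  have [N N0 phiN] := base_image_killed phiT.
  apply/(finitaryP dT); exists N => // x; apply: killedP => // [|q qN].
    by apply/torsionP; exact: dT.
  rewrite -[coord q _]/(coord q (phi x - twist (weights phi) x)) raddfB/=.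
  by rewrite (coord_twist_weights x phiN)// subrr.
by apply: rpredD; [exact: twist_annihilates_mod_torsion|exact: finitary_into_torsion].
Qed.

(** * The quotient modulo finitary endomorphisms *)

Definition torsion_hom_quot : set {quot @finitary A} :=
  quot_set (@finitary A) into_torsion.

Lemma into_torsion_quot_subgroup : is_subgroup torsion_hom_quot.
Proof.
split=> [|_ _ [phi phiT <-] [psi psiT <-]].
  by exists 0; [move=> x; rewrite rpred0|rewrite raddf0].
by exists (phi - psi); [exact: into_torsionB|rewrite raddfB].
Qed.

(** If M kills n phi then n M kills phi. *)
Lemma into_torsion_quot_torsion_free : is_torsion_free torsion_hom_quot.
Proof.
move=> _ n [phi phiT <-] n0; rewrite -raddfMn => /pi_eq0.
move=> /(finitaryP (into_torsionMn n phiT))[M M0 MP]; apply/pi_eq0/(finitaryP phiT).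
exists (n * M)%N; first by rewrite muln_gt0 n0.
by move=> x; rewrite mulrnA -endoMn.
Qed.

(** The weights can be divided by n at all primes not dividing n. *)
Lemma into_torsion_quot_divisible : is_divisible torsion_hom_quot.
Proof.
move=> _ n [phi phiT <-] n0; have [N N0 phiN] := base_image_killed phiT.
pose psi := twist_endo (fun q => weights phi q / n%:R).
have psiT : into_torsion psi := twist_annihilates_mod_torsion _.
exists (\pi_({quot @finitary A})%qT psi); first by exists psi.
rewrite -raddfMn; apply/pi_eq.
have dT := into_torsionB (into_torsionMn n psiT) phiT.
apply/(finitaryP dT).
exists (N * n)%N => [|x]; first by rewrite muln_gt0 N0.
apply: killedP; [by rewrite muln_gt0 N0|by apply/torsionP; exact: dT|].
move=> q; rewrite coprimeMr => /andP[qN qn].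
rewrite -[coord q _]/(coord q ((psi *+ n) x - phi x)) endoMn raddfB raddfMn/=.
rewrite coord_twist (coord_image _ phiN)// mulrAC -mulrnAr Zq_invn// mulr1.
by rewrite subrr.
Qed.

Lemma Zq_fresh (q : prime_nat) (s : seq 'Z_(val q)) :
  (size s < val q)%N -> exists x, x \notin s.
Proof.
move=> sq; apply/existsP; apply: contraLR sq => /existsPn sP; rewrite -leqNgt.
have e : #|'Z_(val q)| = val q by rewrite card_ord (Zp_cast (prime_nat_gt1 q)).
rewrite -[leqLHS]e; apply: leq_trans (card_size s); apply/subset_leq_card/fintype.subsetP => x _.
exact/negPn/sP.
Qed.

(** Diagonal argument.  Two endomorphisms with the same class have the same
    weights at almost all primes, so the new family of weights has to differ
    from the i-th one at infinitely many primes: at q it avoids the weights of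
    the first q - 1 endomorphisms, which cannot exhaust Z/q. *)
Lemma into_torsion_quot_uncountable : ~ countable torsion_hom_quot.
Proof.
move=> /countable_injP[code codeI].
pose pi := \pi_({quot @finitary A})%qT.
(* Representatives of all the classes, indexed by their codes. *)
have /choice[enum enumP] : forall i, exists phi : endo A, into_torsion phi /\
    forall psi, into_torsion psi -> code (pi psi) = i -> pi phi = pi psi.
  move=> i; have [[phi [phiT ci]]|no] :=
    pselect (exists phi, into_torsion phi /\ code (pi phi) = i).
    exists phi; split=> // psi psiT cpsi; apply: codeI; rewrite ?cpsi//.
      by apply/mem_set; exists phi.
    by apply/mem_set; exists psi.
  exists 0; split=> [x|psi psiT cpsi]; first by rewrite rpred0.
  by case: no; exists psi.
have fresh : forall q : prime_nat, exists z : 'Z_(val q),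
    z \notin [seq coord q (enum i (base_over q)) | i <- iota 0 (val q).-1].
  by move=> q; apply: Zq_fresh; rewrite size_map size_iota prednK ?prime_nat_gt0.
pose a : Zprod := fun q => sval (cid (fresh q)).
have aP q : a q \notin _ := svalP (cid (fresh q)).
have aT := @twist_annihilates_mod_torsion a.
set i := code (pi (twist_endo a)).
have [eT /(_ _ aT erefl)/pi_eq] := enumP i.
move=> /(finitaryP (into_torsionB eT aT))[M M0 MP].
have [p Mp pr] := prime_above (M + i.+1).
pose q := to_prime_nat pr.
have qM : coprime (val q) M.
  by rewrite prime_coprime// gtnNdvd// (leq_trans _ Mp)// ltnS leq_addr.
have := coord_killed qM (MP (base_over q)).
rewrite -[coord q _]/(coord q (enum i (base_over q) - twist a (base_over q))).
rewrite raddfB/= coord_twist_over => /eqP; rewrite subr_eq0 => /eqP e.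
have /negP[] := aP q; apply/mapP; exists i; rewrite ?e// mem_iota/= add0n.
by rewrite -ltnS prednK ?(prime_nat_gt0 q)// (leq_trans _ Mp)// ltnS leq_addl.
Qed.

(** * Uniform endomorphisms *)

Section Multiples.
Variables (V : zmodType) (z : V).

Definition multiples : {pred V} := fun x => `[< exists m : int, x = z *~ m >].

Fact multiples_zmod_closed : zmod_closed multiples.
Proof.
split=> [|_ _ /asboolP[m ->] /asboolP[n ->]]; apply/asboolP.
  by exists 0; rewrite mulr0z.
by exists (m - n); rewrite mulrzBr.
Qed.

HB.instance Definition _ :=
  GRing.isZmodClosed.Build V multiples multiples_zmod_closed.

Lemma lin_indep_singleton :
  (forall m : int, z *~ m = 0 -> m = 0) -> lin_indep [set z].
Proof.
move=> z0 [|a [|b s]] c us sz.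
- by [].
- rewrite big_seq1 (sz a) ?mem_head// => /z0 ca x.
  by rewrite inE => /eqP->.
have az : a = z by apply: sz; rewrite mem_head.
have bz : b = z by apply: sz; rewrite !inE eqxx orbT.
by move: us; rewrite az bz /= inE eqxx.
Qed.
End Multiples.

Section NMultiples.
Variables (V : zmodType) (n : nat).
Definition nmultiples : {pred V} := fun x => `[< exists y : V, x = y *+ n >].

Fact nmultiples_zmod_closed : zmod_closed nmultiples.
Proof.
split=> [|_ _ /asboolP[x ->] /asboolP[y ->]]; apply/asboolP.
  by exists 0; rewrite mul0rn.
by exists (x - y); rewrite mulrnBl.
Qed.

HB.instance Definition _ :=
  GRing.isZmodClosed.Build V nmultiples nmultiples_zmod_closed.
End NMultiples.
Arguments nmultiples {V} n.

Lemma multiples_span (V : zmodType) (z : V) :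
  [set` multiples z] = int_span [set z].
Proof.
apply/seteqP; split=> [_ /asboolP[m ->]|_ [s [c [sz ->]]]].
  exists [:: z], (fun=> m); rewrite big_seq1; split=> // x.
  by rewrite inE => /eqP.
rewrite /= big_seq; apply: rpred_sum => x /sz ->; apply: rpredMz.
by apply/asboolP; exists 1.
Qed.

(** Induction on the factorization of n: by [A_decomp], A/qA has at most q^2
    elements for q prime. *)
Lemma A_mod_finite n : (0 < n)%N ->
  exists s : seq A, forall x, exists2 r, r \in s & exists y, x = r + y *+ n.
Proof.
elim/ltn_ind: n => n IH n0; have [n1|n1] := leqP n 1.
  have -> : n = 1%N by apply/eqP; rewrite eqn_leq n1.
  by exists [:: 0] => x; exists 0; [rewrite inE|exists x; rewrite add0r].
pose q := to_prime_nat (pdiv_prime n1).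
have [||s sP] := IH (n %/ val q)%N.
- by rewrite ltn_Pdiv// prime_nat_gt1.
- by rewrite divn_gt0 ?prime_nat_gt0// dvdn_leq// pdiv_dvd.
exists [seq base_over q *+ kj.1 + base *+ kj.2 + r *+ val q |
         kj <- [seq (k, j) | k <- iota 0 (val q), j <- iota 0 (val q)], r <- s].
move=> x; have [k [j [y [kq jq _ xE]]]] := A_decomp q x.
have [r rs [y' yE]] := sP y.
exists (base_over q *+ k + base *+ j + r *+ val q).
  apply/allpairsP; exists ((k, j), r); split=> //=.
  by apply/allpairsP; exists (k, j); rewrite !mem_iota.
exists y'; rewrite {1}xE yE mulrnDl addrA -mulrnA divnK//.
exact: pdiv_dvd.
Qed.

Lemma quot_nmultiples_finite n : (0 < n)%N ->
  finite_set (quot_set (nmultiples n : zmodClosed A) [set: A]).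
Proof.
move=> /A_mod_finite[s sP].
apply: (sub_finite_set _ (finite_image \pi_({quot nmultiples n})%qT (finite_seq s))).
move=> _ [x _ <-]; have [r rs [y ->]] := sP x; exists r => //.
apply/pi_eq; rewrite opprD addrA subrr sub0r rpredN.
by apply/asboolP; exists y.
Qed.

Fact padic_of_nat_coherent p e n : (e %% p ^ n = (e %% p ^ n.+1) %% p ^ n)%N.
Proof. by rewrite modn_dvdm// dvdn_exp2l. Qed.

Definition padic_of_nat p (e : nat) : padic_int p :=
  PadicInt (padic_of_nat_coherent p e).

Lemma mulrn_mod (V : zmodType) (x : V) e m : x *+ m = 0 -> x *+ (e %% m) = x *+ e.
Proof.
by move=> x0; rewrite [in RHS](divn_eq e m) mulrnDr mulnC mulrnA x0 mul0rn add0r.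
Qed.

Lemma base_mulrz_eq0 N (m : int) : (0 < N)%N -> base *+ N *~ m = 0 -> m = 0.
Proof.
move=> N0 /(congr1 slope); rewrite raddfMz raddfMn raddf0/= slope_base => /eqP.
by rewrite mulrz_eq0 pnatr_eq0 [N == _]eqn0Ngt N0 orbF => /eqP.
Qed.

Lemma natr_mulrz (R : pzRingType) N (z : int) :
  N%:R *~ z = (z * N%:Z)%:~R :> R.
Proof. by rewrite -mulrzr mulr_natl rmorphM/= -pmulrn mulr_natr. Qed.

(** Write F for the multiples of [base *+ N] and w for the weights of phi.  If
    x is p-primary modulo F, the slope of x has no pole off p, so that p x has
    an integral slope m = d N, and p x is d N [base] with coordinate 0 at p.
    On the other hand phi(x) has the single coordinate w_p m, at p.  As k = - w_p
    in Z/p, the two add up: phi(x) - p k x = - k d N [base]. *)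
Lemma acts_off_bad_primes (phi : endo A) N (p : prime_nat) n (c : int) k x :
  phi base *+ N = 0 -> coprime (val p) N ->
  into_torsion phi -> k%:R = - weights phi p ->
  x *+ (val p ^ n) = base *+ N *~ c ->
  phi x - x *+ (val p * k) \in multiples (base *+ N).
Proof.
move=> phiN pN phiT kE xc.
have slope_c : slope x *+ (val p ^ n) = (c * N)%:~R.
  by rewrite -raddfMn xc raddfMz raddfMn/= slope_base natr_mulrz.
have off q : q != p -> coprime (val q) (val p ^ n).
  by move=> qp; rewrite coprimeXr// prime_nat_coprime.
have [q|m mE] := @integral_everywhere (slope x *+ val p).
  have [->|qp] := eqVneq q p; first exact: slope_simple_poles.
  apply: (@coprime_integral_at _ (val p ^ n) _ (c * N *+ val p)); first exact: off.
  by rewrite mulrnAC slope_c rmorphMn.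
have mpn : m *+ (val p ^ n) = c * N *+ val p.
  by apply: (@intr_inj rat); rewrite !rmorphMn/= -mE mulrnAC slope_c.
have [d dE] : exists d, m = d * N%:Z.
  apply/dvdzP; rewrite dvdzE absz_nat.
  rewrite -(@Gauss_dvdl _ _ (val p ^ n)); last first.
    by rewrite coprime_sym coprimeXl.
  have := congr1 absz mpn; rewrite -[m *+ _]mulr_natr natz abszM absz_nat => ->.
  by rewrite -mulrnAl abszM absz_nat dvdn_mull.
have mk (R : pzRingType) :
    0 - (d * N%:Z)%:~R *+ k = (- (k%:Z * d) * N%:Z)%:~R :> R.
  rewrite sub0r mulNr rmorphN/= -rmorphMn/= -mulrnAl.
  by rewrite -[d *+ k]mulr_natl natz.
apply/asboolP; exists (- (k%:Z * d)).
apply: A_ext => [|q].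
  rewrite raddfB/= raddfMn/= raddfMz/= [slope (base *+ _)]raddfMn/= slope_base; have /torsionP-> := phiT x.
  by rewrite mulrnA mE dE natr_mulrz mk.
rewrite raddfB/= raddfMn/= raddfMz/= [coord q (base *+ _)]raddfMn/= coord_base natr_mulrz.
have [->|qp] := eqVneq q p.
  rewrite (coord_image _ phiN)// -/(weights phi p) mulrnA Zq_mulrn_char mul0rn subr0.
  rewrite /residue mE ratr_int dE mulNr rmorphN/= -mulrA [in RHS]rmorphM/=.
  by rewrite -[k%:~R]/(k%:R) kE mulNr opprK.
have -> : coord q (phi x) = 0.
  apply: (coord_killed (off _ qp)).
  by rewrite -raddfMn/= xc raddfMz raddfMn/= phiN mul0rz.
have xp : coord q x *+ val p = m%:~R.
  apply: (Zq_mulrnI (off _ qp)); rewrite mulrnAC -[coord q x *+ _]raddfMn/= xc.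
  by rewrite raddfMz raddfMn/= coord_base natr_mulrz -!rmorphMn/= mpn.
by rewrite mulrnA xp dE mk.
Qed.

(** An element of NA that is p-primary modulo F, for p dividing N, has an image
    that is both p-primary and in N T, which has no p-component. *)
Lemma vanishes_at_bad_primes (phi : endo A) N (p : prime_nat) n (c : int) y :
  phi base *+ N = 0 -> ~~ coprime (val p) N ->
  into_torsion phi -> y *+ N *+ (val p ^ n) = base *+ N *~ c ->
  phi (y *+ N) = 0.
Proof.
move=> phiN pN phiT yc; apply: A_ext => [|q].
  by rewrite raddf0; apply/torsionP.
rewrite raddf0; have [qN|] := boolP (coprime (val q) N); last first.
  rewrite prime_coprime ?(valP q)// negbK => qN.
  by rewrite !raddfMn/= Zq_mulrn_dvd.
apply: (@coord_killed _ _ (val p ^ n)).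
  by rewrite coprimeXr// prime_nat_coprime//; apply: contraNneq pN => <-.
by rewrite -raddfMn/= yc raddfMz raddfMn/= phiN mul0rz.
Qed.

(** F is generated by [base *+ N] and A0 = NA; the coordinate of the multiplier
    at p is - p w_p if p does not divide N, and 0 otherwise. *)
Lemma into_torsion_uniform (phi : endo A) : into_torsion phi -> uniform phi.
Proof.
move=> phiT; have [N N0 phiN] := base_image_killed phiT.
pose alpha : J := fun p => padic_of_nat (val p)
  (if coprime (val p) N then val p * (- weights phi p : 'Z_(val p))%R else 0)%N.
exists (multiples (base *+ N) : zmodClosed A), (nmultiples N : zmodClosed A), alpha; split; split.
- move=> _ /asboolP[m ->]; apply/asboolP; exists (base *~ m).
  by rewrite [base *+ N]pmulrn mulrzAC -pmulrn.
- move=> _ /asboolP[m ->]; rewrite raddfMz raddfMn/= phiN mul0rz; exact: rpred0.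
- move=> _ /asboolP[y ->]; apply/asboolP; exists (phi y); exact: raddfMn.
- exact: quot_nmultiples_finite.
- move=> _ [x _ <-]; have [n n0 [m xm]] := multiple_base x.
  apply/asboolP; exists (n * N)%N; first by rewrite muln_gt0 n0.
  rewrite -raddfMn; apply/pi_eq0/asboolP; exists m.
  by rewrite mulrnA xm pmulrn mulrzAC.
- move=> p n _ /asboolP[y ->] px; rewrite /= mulrn_mod//.
  move: px; rewrite -raddfMn => /pi_eq0/asboolP[c yc].
  rewrite -raddfMn; apply/pi_eq; case: ifPn => pN.
    by apply: acts_off_bad_primes yc => //; exact: natr_Zp (- weights phi p).
  rewrite mulr0n subr0 (vanishes_at_bad_primes phiN pN phiT yc); exact: rpred0.
- exists [set base *+ N]; split; last exact: multiples_span.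
  by apply: lin_indep_singleton => m; exact: base_mulrz_eq0.
- by move=> _ /asboolP[m ->]; rewrite raddfMz raddfMn/= phiN mul0rz.
Qed.

(** Both A/A0 and A0/F are periodic and phi vanishes on F. *)
Lemma uniform_into_torsion (phi : endo A) : uniform phi -> into_torsion phi.
Proof.
move=> [F [A0 [alpha [[_ _ _ finA0] [torA0 _ _ phiF]]]]] x.
have [|m [n [mn]]] := finite_repeat (u := fun n => \pi_({quot A0})%qT (x *+ n)) finA0.
  by move=> n; exists (x *+ n).
move=> /esym/pi_eq; rewrite -mulrnBr ?(ltnW mn)// => xA0.
have /torA0/asboolP[k k0] : quot_set F [set` A0] (\pi_({quot F})%qT (x *+ (n - m))).
  by exists (x *+ (n - m)).
rewrite -raddfMn => /pi_eq0/phiF; rewrite !raddfMn => e.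
apply/asboolP; exists ((n - m) * k)%N; first by rewrite muln_gt0 subn_gt0 mn.
by rewrite mulrnA.
Qed.

(** * The invariants of the group *)

Lemma A_rank : has_torsion_free_rank A 1.
Proof.
pose pi := \pi_({quot @torsion A})%qT.
exists [set pi base]; split; first exact: card_set1.
  apply: lin_indep_singleton => m; rewrite -raddfMz => /pi_eq0/torsionP.
  by rewrite raddfMz/= slope_base => /eqP; rewrite mulrz_eq0 oner_eq0 orbF => /eqP.
move=> C baseC Cfree y Cy; apply: contrapT => yb.
have [x xy] : exists x, pi x = y by exists (repr y); exact: reprK.
set d := denq (slope x); set e := numq (slope x).
have rel : y *~ d = pi base *~ e.
  rewrite -xy -!raddfMz; apply/pi_eq/torsionP.
  rewrite raddfB/= !raddfMz/= slope_base -[slope x *~ d]mulrzr.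
  rewrite -[X in X * _]divq_num_den divfK; first by rewrite mulNrz subrr.
  by rewrite intr_eq0 denq_neq0.
have /negP[] := denq_neq0 (slope x); apply/eqP.
have yb' : pi base == y = false by apply/eqP => by_; apply: yb; rewrite -by_.
have := Cfree [:: y; pi base] (fun z => if z == y then d else - e).
move=> /(_ _ _ _ y (mem_head _ _)); rewrite eqxx; apply.
- by rewrite /= inE eq_sym yb'.
- by move=> z; rewrite !inE => /orP[/eqP->//|/eqP->]; exact: baseC.
- by rewrite big_cons big_seq1 eqxx yb' rel mulrNz subrr.
Qed.

Lemma A_p_component p : prime p -> p_component A p #= `I_p.
Proof.
move=> pr; pose q := to_prime_nat pr.
have off (q' : prime_nat) n : q' != q -> coprime (val q') (p ^ n).
  by move=> qq'; rewrite coprimeXr//; exact: prime_nat_coprime qq'.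
have p0 n : (0 < p ^ n)%N by rewrite expn_gt0 prime_gt0.
have inj : {in p_component A p &, injective (fun x => coord q x : nat)}.
  move=> x y /set_mem[m xm] /set_mem[n yn] xy; apply: A_ext => [|q'].
    by rewrite (killed_torsion (p0 m) xm) (killed_torsion (p0 n) yn).
  have [->|qq'] := eqVneq q' q; first exact: val_inj.
  by rewrite (coord_killed (off _ _ qq') xm) (coord_killed (off _ _ qq') yn).
have <- : [set (coord q x : nat) | x in p_component A p] = `I_p.
  apply/seteqP; split=> [_ [x _ <-]|k /= kp].
    by rewrite /= -[ltnRHS](Zp_cast (prime_gt1 pr)).
  pose f : Zprod := fun q' => k%:R *+ (q' == q).
  have [||x x0 xf] := @A_intro 0 f.
  - by move=> q'; rewrite mul0rn; exact: (integral_at_int _ 0).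
  - exists p; rewrite ?prime_gt0//; exists 0 => [|q' q'p]; first exact: mul0rn.
    rewrite /f; case: eqP => [e|_]; last by rewrite mul0rn.
    by move: q'p; rewrite e /coprime gcdnn eqn_leq leqNgt prime_gt1.
  exists x; last by rewrite xf /f eqxx val_Zp_nat ?prime_gt1// modn_small.
  exists 1%N; apply: killedP => // q' /=; rewrite expn1 => q'p.
  rewrite xf /f; case: eqP => // e.
  by move: q'p; rewrite e /coprime gcdnn eqn_leq leqNgt prime_gt1.
rewrite card_eq_sym; exact: inj_card_eq inj.
Qed.

Theorem corollary2 :
  exists A : zmodType,
    let X : set (endo A) :=
      [set phi | annihilates_mod_torsion phi /\ annihilates_torsion phi] in
    let UI_mod_F : set {quot @finitary A} := quot_set (@finitary A) (UI A) in
    [/\ has_torsion_free_rank A 1,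
        forall p : nat, prime p -> p_component A p #= `I_p,
        [set phi : endo A | inertial phi /\ annihilates_mod_torsion phi] = UI A
          /\ UI A = [set xi + eta | xi in X & eta in [set` @finitary A]],
        exists f : {additive zmod_prod (fun p : prime_nat => 'Z_(val p) : zmodType)
                      -> endo A},
          injective f /\ range f = X &
        [/\ is_subgroup UI_mod_F, ~ countable UI_mod_F,
            is_torsion_free UI_mod_F & is_divisible UI_mod_F]].
Proof.
have UIE : UI A = into_torsion.
  apply/seteqP; split=> phi; first by move=> [_ /uniform_into_torsion].
  by move=> phiT; split; [exact: inertial_into_torsion|exact: into_torsion_uniform].
exists A => X UI_mod_F; rewrite /UI_mod_F /X UIE; split.
- exact: A_rank.
- exact: A_p_component.
- split; last by rewrite into_torsion_decomp twist_endo_range.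
  apply/seteqP; split=> phi; first by case.
  by move=> phiT; split=> //; exact: inertial_into_torsion.
- by exists twist_endo; split; [exact: twist_endo_inj|exact: twist_endo_range].
split.
- exact: into_torsion_quot_subgroup.
- exact: into_torsion_quot_uncountable.
- exact: into_torsion_quot_torsion_free.
- exact: into_torsion_quot_divisible.
Qed.
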